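(* Let $f(t)=\sum_{k\ge1}\frac{c_k}{k!}t^k$ with $c_1\ne0$, $g(t)=t/f(t)=\sum_{k\ge0}\frac{a_k}{k!}t^k$, let $P=\sum_T P(T)(t)\,T\in\mathcal{T}[t]$ be the solution of $P'=\langle g(D)|P\rangle\curvearrowright P$, $P(0)=\bullet$, and set $p(T)(t)=|\mathrm{Aut}(T)|\cdot P(T)(t)$ for every rooted tree $T$. Then $p(\bullet)(t)=1$ and: (I) for rooted trees $T_1,\ldots,T_k$, $k\ge1$: $p(\{T_1,\ldots,T_k|\bullet\})=p(\{T_1|\bullet\})\cdots p(\{T_k|\bullet\})$; (II) for every rooted tree $T$: $p(\{T|\bullet\})(t)=\int_0^t g(D)p(T)(\tau)\,d\tau$. These relations determine all the polynomials $p(T)(t)$.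
   Context: $\mathbb{K}$ is a field of characteristic zero. A rooted tree is a finite (non-planar) tree with a distinguished root; $\mathrm{Aut}(T)$ is its group of root-preserving automorphisms. $\mathcal{T}=\prod_{n\ge1}\mathcal{T}(n)$, where $\mathcal{T}(n)$ is spanned by isomorphism classes of rooted trees with $n$ vertices; $T\curvearrowright T'=\sum_{v\in V(T')}T\searrow_vT'$, where $T\searrow_vT'$ adds an edge from the root of $T$ to the vertex $v$ of $T'$ and keeps the root of $T'$. $\bullet$ is the one-vertex tree; for rooted trees $T_1,\ldots,T_k$, $\{T_1,\ldots,T_k|\bullet\}$ denotes the rooted tree obtained by taking a new root vertex and joining it by an edge to the root of each $T_i$. $\mathcal{T}[t]$ consists of formal sums $\sum_TP(T)(t)T$ with polynomial coefficients, with $\curvearrowright$ extended $\mathbb{K}[t]$-bilinearly and derivative taken coefficientwise. $\langle g(D)|\cdot\rangle$ is the functional $t^n\mapsto a_n$ extended coefficientwise. $g(D)\colon\mathbb{K}[t]\to\mathbb{K}[t]$ is the linear operator $t^n\mapsto a_n(t):=\sum_{j=0}^n\binom{n}{j}a_{n-j}t^j$. *)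

(* Defs.v *)
From HB Require Import structures.
From mathcomp Require Import all_boot all_order all_algebra perm.

Set Implicit Arguments.
Unset Strict Implicit.
Unset Printing Implicit Defensive.

Import GRing.Theory.
Local Open Scope quotient_scope.

Section TreeGraphs.
Variable V : finType.
Implicit Types (e : rel V) (x y z : V).

(* A cycle with pairwise distinct vertices has length at most #|V|, so the
   bounded quantification below covers all of them; see [acyclicP]. *)
Definition acyclic e : bool :=
  [forall n : 'I_#|V|.+1, forall c : n.-tuple V, ucycleb e c ==> (n <= 2)].

Definition is_tree e : bool :=
  [&& [forall x, ~~ e x x], [forall x, forall y, e x y == e y x],
      [forall x, forall y, connect e x y] & acyclic e].

Lemma acyclicP e :
  reflect (forall c : seq V, ucycle e c -> size c <= 2) (acyclic e).
Proof.
apply: (iffP forallP) => [H c ce | H n].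
  have lt : size c < #|V|.+1 by case/andP: ce => _ /card_uniqP <-; exact: max_card.
  by have /forallP/(_ (in_tuple c))/implyP/(_ ce) := H (Ordinal lt).
by apply/forallP => c; apply/implyP => /H; rewrite size_tuple.
Qed.

(* A parent map and a depth function witnessing that [e] is a tree. *)
Definition ranked e r (d : {ffun V -> V} * {ffun V -> nat}) : bool :=
  [forall x, (x != r) ==> (d.2 (d.1 x) < d.2 x)] &&
  [forall x, forall y,
     e x y == ((x != r) && (d.1 x == y)) || ((y != r) && (d.1 y == x))].

Lemma ranked_tree e r d : ranked e r d -> is_tree e.
Proof.
case: d => par h /andP[/forallP /= hP /forallP /= eP].
have ltp x : x != r -> h (par x) < h x by move/(implyP (hP x)).
have eE x y : e x y = ((x != r) && (par x == y)) || ((y != r) && (par y == x)).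
  by move/forallP/(_ y)/eqP: (eP x).
have esym x y : e x y = e y x by rewrite !eE orbC.
have eirr x : ~~ e x x.
  rewrite eE orbb; apply/negP => /andP[/ltp lt /eqP xE].
  by rewrite xE ltnn in lt.
have conr x : connect e x r.
  have [n] := ubnP (h x); elim: n x => // n IHn x.
  rewrite ltnS => le; have [->|xr] := eqVneq x r; first exact: connect0.
  apply: (connect_trans (connect1 _) (IHn (par x) _)).
    by rewrite eE xr eqxx.
  exact: leq_trans (ltp _ xr) le.
apply/and4P; split.
- by apply/forallP => x; exact: eirr.
- by apply/forallP => x; apply/forallP => y; apply/eqP.
- apply/forallP => x; apply/forallP => y.
  by apply: connect_trans (conr x) _; rewrite (sym_connect_sym esym).
apply/acyclicP => c /andP[ce uc]; rewrite leqNgt; apply/negP => sz.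
have [x0 x0c] : exists x, x \in c.
  by case: (c) sz => // a l _; exists a; rewrite mem_head.
case: (arg_maxnP h x0c) => x /= xc xmax.
have up y : e x y -> y \in c -> par x = y.
  rewrite eE => /orP[/andP[_ /eqP] // | /andP[/ltp lt /eqP yE] yc].
  by have := xmax y yc; rewrite /= leqNgt -[X in h X < _]yE lt.
have n1 := up _ (next_cycle ce xc); rewrite mem_next in n1.
have n2 : par x = prev c x.
  by apply: up; rewrite ?mem_prev // esym; exact: prev_cycle.
have np : next c x = prev c x by rewrite -n1 ?n2.
have [i s sE] := rot_to xc.
have : next (x :: s) x = prev (x :: s) x.
  by rewrite -sE next_rot // prev_rot.
have : uniq (x :: s) by rewrite -sE rot_uniq.
have : size (x :: s) = size c by rewrite -sE size_rot.
case: s {sE} => [|y [|z s]] /= => [szE|szE|_].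
- by rewrite -szE in sz.
- by rewrite -szE in sz.
move=> /and3P[xn yn _] E.
move: E; rewrite eqxx => E.
have : y \in z :: s.
  have nz : x \notin z :: s by move: xn; rewrite inE negb_or => /andP[].
  suff -> : y = last z s by exact: mem_last.
  rewrite E; move: nz xn; clear; rewrite !inE !negb_or => /andP[xz xs] /andP[xy _].
  rewrite (negbTE xy) (negbTE xz).
  elim: s z xs xz => [|w s IHs] z //=; rewrite ?eqxx // inE negb_or => /andP[xw xs] xz.
  by rewrite (negbTE xw); exact: IHs.
by rewrite (negbTE yn).
Qed.

Lemma tree_ranked e r : is_tree e -> {d | ranked e r d}.
Proof.
case/and4P => /forallP eirr /forallP esym' /forallP con /acyclicP acy.
have esym x y : e x y = e y x by move/forallP/(_ y)/eqP: (esym' x).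
apply: sigW.
pose P x n := [exists p : n.-tuple V, path e r p && (last r p == x)].
have exP x : exists n, P x n.
  have /connectP[p ep xE] : connect e r x by exact: (forallP (con r)).
  by exists (size p); apply/existsP; exists (in_tuple p); rewrite ep xE eqxx.
pose h x := ex_minn (exP x).
have hle x p : path e r p -> last r p = x -> h x <= size p.
  move=> ep xE; rewrite /h; case: ex_minnP => m _; apply.
  by apply/existsP; exists (in_tuple p); rewrite ep xE eqxx.
have hex x : exists p, [/\ path e r p, last r p = x & size p = h x].
  rewrite /h; case: ex_minnP => m /existsP[p /andP[ep /eqP xE]] _.
  by exists p; rewrite size_tuple.
have h0 x : h x = 0 -> x = r.
  by have [p [_ <- <-]] := hex x; move/size0nil->.
have hr : h r = 0 by apply/eqP; rewrite -leqn0; apply: (hle r [::]).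
have d1 x y : e x y -> h y <= (h x).+1.
  move=> exy; have [p [ep xE <-]] := hex x.
  rewrite -(size_rcons p y); apply: hle; last by rewrite last_rcons.
  by rewrite rcons_path ep xE.
have d2 x : x != r -> exists2 y, e x y & h x = (h y).+1.
  move=> xr; have [p [ep xE sz]] := hex x.
  case/lastP: p ep xE sz => [_ /= rx|p y].
    by rewrite -rx eqxx in xr.
  rewrite rcons_path last_rcons size_rcons => /andP[ep el] yx sz; subst y.
  exists (last r p); first by rewrite esym.
  apply/eqP; rewrite eqn_leq d1 //= -sz ltnS.
  exact: hle.
have d3 n x y : x != y -> h x = n -> h y = n ->
  exists p, [/\ path e x (rcons p y), uniq (x :: rcons p y),
               all (fun z => h z < n) p & 0 < size p].
  elim: n x y => [|n IHn] x y xy hx hy.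
    by rewrite (h0 x hx) (h0 y hy) eqxx in xy.
  have nr z : h z = n.+1 -> z != r.
    by apply: contra_eqN => /eqP->; rewrite hr.
  have [x' exx'] := d2 _ (nr _ hx); rewrite hx => -[hx'].
  have [y' eyy'] := d2 _ (nr _ hy); rewrite hy => -[hy'].
  have nle z (q : seq V) m : n < m -> all (fun w => h w < m) q -> h z = m -> z \notin q.
    move=> nm /allP aq hz; apply/negP => /aq.
    by rewrite hz ltnn.
  have [xy'|xy'] := eqVneq x' y'.
    exists [:: x']; split => //=; last by rewrite andbT -hx'.
      by rewrite exx' xy' esym eyy'.
    rewrite !inE (negbTE xy) orbF andbT; apply/andP; split.
      by apply/eqP => xE; move: hx; rewrite xE -hx' => /eqP; rewrite ltn_eqF.
    by apply/eqP => xE; move: hy; rewrite -xE -hx' => /eqP; rewrite ltn_eqF.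
  have [p [ep up ap _]] := IHn x' y' xy' (Logic.eq_sym hx') (Logic.eq_sym hy').
  have ap' : all (fun z => h z < n.+1) (x' :: rcons p y').
    rewrite /= all_rcons /= -hx' -hy' ltnSn /=.
    by apply: sub_all ap => z /= /ltnW; rewrite ltnS.
  exists (x' :: rcons p y'); split => //.
    by rewrite rcons_cons /= exx' rcons_path ep last_rcons esym.
  rewrite rcons_cons cons_uniq -rcons_cons rcons_uniq up andbT.
  rewrite mem_rcons inE negb_or xy /=.
  by rewrite (nle _ _ n.+1 _ ap' hx) // (nle _ _ n.+1 _ ap' hy).
have d4 x y : e x y -> h x != h y.
  move=> exy; apply/eqP => hxy.
  have xy : x != y by apply: contraL exy => /eqP->; exact: eirr.
  have [p [ep up _ p0]] := d3 _ x y xy erefl (Logic.eq_sym hxy).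
  have : size (x :: rcons p y) <= 2.
    by apply: acy; rewrite /ucycle /= rcons_path ep last_rcons esym exy.
  by rewrite /= size_rcons !ltnS leqNgt p0.
have d5 z x y : e z x -> e z y -> h z = (h x).+1 -> h z = (h y).+1 -> x = y.
  move=> ezx ezy hzx hzy; apply/eqP/negPn/negP => xy.
  have [||p [ep up ap p0]] := d3 (h x) x y xy; [by [] | by move: hzy; rewrite hzx => -[] |].
  have : size (z :: x :: rcons p y) <= 2; last by rewrite /= size_rcons.
  apply: acy; apply/andP; split.
    by rewrite /= ezx rcons_path ep last_rcons esym.
  rewrite cons_uniq up andbT -rcons_cons mem_rcons inE negb_or; apply/andP; split.
    by apply: contraL ezy => /eqP->; exact: eirr.
  rewrite inE negb_or; apply/andP; split.
    by apply: contraL ezx => /eqP->; exact: eirr.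
  apply/negP => /(allP ap); rewrite hzx => /ltnW.
  by rewrite ltnn.
pose par x := odflt r [pick y | e x y && (h x == (h y).+1)].
have parP x : x != r -> e x (par x) && (h x == (h (par x)).+1).
  move=> xr; rewrite /par; case: pickP => [y //|none].
  by have [y exy hxy] := d2 _ xr; have := none y; rewrite exy hxy eqxx.
exists ([ffun x => par x], [ffun x => h x]); apply/andP; split.
  apply/forallP => x; apply/implyP => xr; rewrite !ffunE.
  by have /andP[_ /eqP->] := parP _ xr.
apply/forallP => x; apply/forallP => y; rewrite !ffunE; apply/eqP.
have H u v : e u v -> h v < h u -> (u != r) && (par u == v).
  move=> euv lt; have ur : u != r by apply: contraTN lt => /eqP->; rewrite hr.
  rewrite ur /=; have /andP[ep /eqP hp] := parP _ ur.
  apply/eqP; apply: (d5 u) => //; apply/eqP.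
  by rewrite eqn_leq lt andbT d1 // esym.
apply/idP/idP => [exy|/orP[]].
- have := d4 _ _ exy; rewrite neq_ltn => /orP[lt|lt].
    by rewrite orbC H // esym.
  by rewrite H.
- by case/andP => xr /eqP<-; case/andP: (parP _ xr).
- by case/andP => xr /eqP<-; rewrite esym; case/andP: (parP _ xr).
Qed.

End TreeGraphs.

Record rtree (V : finType) := RTree {
  rt_data : {set V * V} * V;
  _ : is_tree [rel x y | (x, y) \in rt_data.1] }.

HB.instance Definition _ (V : finType) := [isSub for @rt_data V].
HB.instance Definition _ (V : finType) := [Finite of rtree V by <:].

Definition adj (V : finType) (T : rtree V) : rel V :=
  [rel x y | (x, y) \in (rt_data T).1].
Definition root (V : finType) (T : rtree V) : V := (rt_data T).2.

Lemma adj_tree (V : finType) (T : rtree V) : is_tree (adj T).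
Proof. by case: T. Qed.

Lemma mk_rtree_subproof (V : finType) (e : rel V) (r : V) : is_tree e ->
  is_tree [rel x y | (x, y) \in ([set p | e p.1 p.2], r).1].
Proof.
move=> te; have [d /andP[dP /forallP eP]] := tree_ranked r te.
apply: (@ranked_tree _ _ r d); rewrite /ranked dP /=.
by apply/forallP => x; apply/forallP => y; rewrite inE /=; move/forallP: (eP x).
Qed.

Definition mk_rtree (V : finType) (e : rel V) (r : V) (te : is_tree e) : rtree V :=
  RTree (mk_rtree_subproof r te).

Lemma adj_mk (V : finType) (e : rel V) r (te : is_tree e) :
  adj (mk_rtree r te) =2 e.
Proof. by move=> x y; rewrite /adj /= inE. Qed.

Lemma root_mk (V : finType) (e : rel V) r (te : is_tree e) :
  root (mk_rtree r te) = r.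
Proof. by []. Qed.

Definition is_iso (V W : finType) (T : rtree V) (T' : rtree W) (f : V -> W) : bool :=
  [&& injectiveb f, [forall w, w \in codom f], f (root T) == root T'
    & [forall x, forall y, adj T' (f x) (f y) == adj T x y]].

Definition iso (V W : finType) (T : rtree V) (T' : rtree W) : bool :=
  [exists f : {ffun V -> W}, is_iso T T' f].

Definition Aut (V : finType) (T : rtree V) : {set {perm V}} :=
  [set s : {perm V} | is_iso T T s].

Lemma is_isoP (V W : finType) (T : rtree V) (T' : rtree W) (f : V -> W) :
  reflect [/\ bijective f, f (root T) = root T'
             & forall x y, adj T' (f x) (f y) = adj T x y] (is_iso T T' f).
Proof.
apply: (iffP and4P) => [[/injectiveP fi /forallP fs /eqP fr /forallP fa]|].
  split=> //; last by move=> x y; move/forallP/(_ y)/eqP: (fa x).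
  apply: inj_card_bij => //; rewrite -(card_codom fi).
  by apply: subset_leq_card; apply/subsetP => w _; exact: fs.
case=> fb fr fa; split; first exact/injectiveP/bij_inj.
- case: fb => g fK gK; apply/forallP => w; rewrite -(gK w); exact: codom_f.
- exact/eqP.
- by apply/forallP => x; apply/forallP => y; rewrite fa.
Qed.

Lemma isoP (V W : finType) (T : rtree V) (T' : rtree W) :
  reflect (exists f : V -> W, is_iso T T' f) (iso T T').
Proof.
apply: (iffP existsP) => [[f]|[f /is_isoP[fb fr fa]]]; first by exists f.
exists (finfun f); apply/is_isoP; split => [||x y].
- by apply: (eq_bij fb) => x; rewrite ffunE.
- by rewrite ffunE.
- by rewrite !ffunE.
Qed.

Lemma iso_refl (V : finType) (T : rtree V) : iso T T.
Proof. by apply/isoP; exists id; apply/is_isoP; split => //; exists id. Qed.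

Lemma iso_sym (V W : finType) (T : rtree V) (T' : rtree W) : iso T T' = iso T' T.
Proof.
suff H (V' W' : finType) (S : rtree V') (S' : rtree W') : iso S S' -> iso S' S.
  by apply/idP/idP; exact: H.
case/isoP => f /is_isoP[[g fK gK] fr fa]; apply/isoP; exists g.
apply/is_isoP; split; first by exists f.
- by rewrite -fr fK.
- by move=> x y; rewrite -fa !gK.
Qed.

Lemma iso_trans (V W X : finType) (T : rtree V) (T' : rtree W) (S : rtree X) :
  iso T T' -> iso T' S -> iso T S.
Proof.
case/isoP => f /is_isoP[fb fr fa] /isoP[g /is_isoP[gb gr ga]].
apply/isoP; exists (g \o f); apply/is_isoP; split; first exact: bij_comp.
- by rewrite /= fr.
- by move=> x y; rewrite /= ga fa.
Qed.

Definition iso_on (n : nat) : rel (rtree 'I_n) := fun T T' => iso T T'.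

Lemma iso_on_equiv n : equiv_class_of (@iso_on n).
Proof.
split=> [T|T T'|T' T S]; rewrite /iso_on.
- exact: iso_refl.
- exact: iso_sym.
- exact: iso_trans.
Qed.

Canonical iso_on_equiv_rel n := EquivRelPack (iso_on_equiv n).

Definition tree_of_size (n : nat) := {eq_quot (iso_on_equiv_rel n)}.

HB.instance Definition _ n := Choice.on (tree_of_size n).
HB.instance Definition _ n := EqQuotient.on (tree_of_size n).
HB.instance Definition _ n : isCountable (tree_of_size n) :=
  CanIsCountable (@reprK _ (tree_of_size n)).
HB.instance Definition _ n : isFinite (tree_of_size n) :=
  CanIsFinite (@reprK _ (tree_of_size n)).

Definition tree := {n : nat & tree_of_size n}.
HB.instance Definition _ := Choice.on tree.

Definition tree_size (S : tree) : nat := tag S.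

Section Relabel.
Variables (V W : finType) (T : rtree V) (f : V -> W) (g : W -> V).
Hypotheses (fK : cancel f g) (gK : cancel g f).

Lemma relabel_tree : is_tree (relpre g (adj T)).
Proof.
have [d /andP[/forallP dP /forallP eP]] := tree_ranked (root T) (adj_tree T).
apply: (@ranked_tree _ _ (f (root T)) ([ffun x => f (d.1 (g x))], [ffun x => d.2 (g x)])).
have neq x : (x != f (root T)) = (g x != root T).
  by rewrite -{1}(gK x) (can_eq fK).
apply/andP; split.
  apply/forallP => x; apply/implyP; rewrite neq !ffunE fK.
  exact: (implyP (dP (g x))).
have E u w : (f u == w) = (u == g w) by rewrite -{1}(gK w) (can_eq fK).
apply/forallP => x; apply/forallP => y; rewrite !ffunE !neq /=.
rewrite !E.
by move/forallP: (eP (g x)); apply.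
Qed.

Definition relabel : rtree W := mk_rtree (f (root T)) relabel_tree.

Lemma relabel_iso : iso T relabel.
Proof.
apply/isoP; exists f; apply/is_isoP; split; first by exists g.
- by rewrite root_mk.
- by move=> x y; rewrite adj_mk /= !fK.
Qed.
End Relabel.

Definition cls (V : finType) (T : rtree V) : tree :=
  Tagged tree_of_size
    (\pi_(tree_of_size #|V|) (relabel T (@enum_rankK V) (@enum_valK V))).

Lemma cls_ord n (T : rtree 'I_n) : cls T = Tagged tree_of_size (\pi_(tree_of_size n) T).
Proof.
rewrite /cls; set T' := relabel _ _ _.
have : iso T' T by rewrite iso_sym; exact: relabel_iso.
move: T'; rewrite card_ord => T' i; congr (Tagged _ _).
exact/eqmodP.
Qed.

Lemma clsP (V W : finType) (T : rtree V) (T' : rtree W) :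
  reflect (cls T = cls T') (iso T T').
Proof.
rewrite /cls.
set S := relabel T _ _; set S' := relabel T' _ _.
have i : iso T S by exact: relabel_iso.
have i' : iso T' S' by exact: relabel_iso.
have -> : iso T T' = iso S S'.
  apply/idP/idP => h.
    by apply: iso_trans (iso_trans _ h) i'; rewrite iso_sym.
  by apply: iso_trans (iso_trans i h) _; rewrite iso_sym.
clearbody S S'; clear i i'; apply: (iffP idP) => [h | E].
  have nm : #|V| = #|W|.
    by case/isoP: (h) => f /is_isoP[fb _ _]; have := bij_eq_card fb; rewrite !card_ord.
  move: #|V| #|W| nm S S' h => n m nm; subst m => S S' h.
  by congr (Tagged _ _); exact/eqmodP.
have nm : #|V| = #|W| by exact: (congr1 tag E).
move: #|V| #|W| nm S S' E => n m nm; subst m => S S' /eqP.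
by rewrite -tag_eqE /tag_eq eqxx tagged_asE /= => /eqP/eqmodP.
Qed.

Lemma card_Aut_iso (V W : finType) (T : rtree V) (T' : rtree W) :
  iso T T' -> #|Aut T| = #|Aut T'|.
Proof.
suff H (V' W' : finType) (S : rtree V') (S' : rtree W') :
    iso S S' -> #|Aut S| <= #|Aut S'|.
  by move=> i; apply/eqP; rewrite eqn_leq !H // iso_sym.
case/isoP => f /is_isoP[[g fK gK] fr fa].
have inj (s : {perm V'}) : injective (f \o s \o g).
  exact: (inj_comp (inj_comp (can_inj fK) (@perm_inj _ s)) (can_inj gK)).
pose F s := perm (inj s).
have FI : injective F.
  move=> s t /permP st; apply/permP => x; have := st (f x).
  by rewrite !permE /= !fK => /(can_inj fK).
rewrite -(card_imset _ FI); apply: subset_leq_card; apply/subsetP => t /imsetP[s].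
rewrite !inE => /is_isoP[_ sr sa] ->; apply/is_isoP; split.
- by apply: injF_bij; exact: perm_inj.
- by rewrite permE /= -fr fK sr.
- by move=> x y; rewrite !permE /= fa sa -fa !gK.
Qed.

Definition bullet_adj : rel unit := fun _ _ => false.

Lemma bullet_tree : is_tree bullet_adj.
Proof.
apply: (@ranked_tree _ _ tt ([ffun=> tt], [ffun=> 0])).
by apply/andP; split; apply/forallP => -[] //; apply/forallP => -[].
Qed.

Definition bullet : rtree unit := mk_rtree tt bullet_tree.

Section Graft.
Variables (V W : finType) (T : rtree V) (v : W) (T' : rtree W).

Definition graft_adj : rel (V + W) := fun a b =>
  match a, b with
  | inl x, inl y => adj T x y
  | inr x, inr y => adj T' x y
  | inl x, inr y | inr y, inl x => (x == root T) && (y == v)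
  end.

Lemma graft_tree : is_tree graft_adj.
Proof.
have [d /andP[/forallP dP /forallP eP]] := tree_ranked (root T) (adj_tree T).
have [d' /andP[/forallP dP' /forallP eP']] := tree_ranked (root T') (adj_tree T').
pose par (a : V + W) : V + W := match a with
  | inl x => if x == root T then inr v else inl (d.1 x)
  | inr y => inr (d'.1 y) end.
pose h (a : V + W) := match a with
  | inl x => (d.2 x + d'.2 v).+1
  | inr y => d'.2 y end.
apply: (@ranked_tree _ _ (inr (root T')) (finfun par, finfun h)).
apply/andP; split.
  apply/forallP => -[x|y]; rewrite !ffunE /=; last exact: dP'.
  case: eqVneq => [_|xr] /=; first by rewrite ltnS leq_addl.
  by rewrite ltnS ltn_add2r; apply: (implyP (dP x)).
apply/forallP => a; apply/forallP => b; rewrite !ffunE /=; apply/eqP.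
case: a b => [x|y] [x'|y'] /=.
- move/forallP/(_ x')/eqP: (eP x) => ->.
  by case: (eqVneq x (root T)); case: (eqVneq x' (root T)).
- rewrite andbF orbF; case: (eqVneq x (root T)) => _ //=.
  by rewrite eq_sym.
- rewrite andbF /=; case: (eqVneq x' (root T)) => _ //=.
  by rewrite eq_sym.
- by move/forallP/(_ y')/eqP: (eP' y) => ->.
Qed.

(* T \searrow_v T' *)
Definition graft : rtree (V + W)%type := mk_rtree (inr (root T')) graft_tree.
End Graft.

Section Join.
Variables (k : nat) (V : 'I_k -> finType) (T : forall i, rtree (V i)).

Definition join_adj : rel (option {i : 'I_k & V i}) := fun a b =>
  match a, b with
  | Some x, Some y => (tag x == tag y) && adj (T (tag x)) (tagged x) (tagged_as x y)
  | None, Some x | Some x, None => tagged x == root (T (tag x))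
  | None, None => false
  end.

Lemma join_tree : is_tree join_adj.
Proof.
pose D i := tree_ranked (root (T i)) (adj_tree (T i)).
pose par (a : option {i : 'I_k & V i}) : option {i : 'I_k & V i} :=
  if a is Some x then
    if tagged x == root (T (tag x)) then None
    else Some (Tagged V ((sval (D (tag x))).1 (tagged x)))
  else None.
pose h (a : option {i : 'I_k & V i}) :=
  if a is Some x then ((sval (D (tag x))).2 (tagged x)).+1 else 0.
apply: (@ranked_tree _ _ None (finfun par, finfun h)).
apply/andP; split.
  apply/forallP => -[[i x]|]; rewrite !ffunE //=.
  have := svalP (D i); case/andP=> [/forallP/(_ x) dP _].
  by case: eqVneq dP => //= _; rewrite ltnS.
apply/forallP => a; apply/forallP => b; rewrite !ffunE /=; apply/eqP.
case: a b => [[i x]|] [[j y]|] //=.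
- have [ij|ij] := eqVneq i j; last first.
    have SF (u : V i) (w : V j) : (Some (Tagged V u) == Some (Tagged V w)) = false.
      by apply/eqP => /Some_inj/(congr1 tag) /= E; rewrite E eqxx in ij.
    have SF' (u : V i) (w : V j) : (Some (Tagged V w) == Some (Tagged V u)) = false.
      by rewrite eq_sym SF.
    by case: ifP => _; case: ifP => _ //; rewrite ?SF ?SF'.
  subst j; rewrite tagged_asE /=.
  have SE (u w : V i) : (Some (Tagged V u) == Some (Tagged V w)) = (u == w).
    by rewrite (inj_eq (@Some_inj _)) eq_Tagged.
  have := svalP (D i); case/andP=> [_ /forallP/(_ x)/forallP/(_ y)/eqP->].
  by case: (eqVneq x (root (T i))) => _; case: (eqVneq y (root (T i))) => _ //=; rewrite ?SE.
- by case: eqVneq; rewrite ?orbF.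
- by case: eqVneq.
Qed.

(* {T_1, ..., T_k | \bullet} *)
Definition join : rtree (option {i : 'I_k & V i}) := mk_rtree None join_tree.
End Join.

(* The coefficient of S in T \curvearrowright T'. *)
Definition graft_coef (V W : finType) (T : rtree V) (T' : rtree W) (S : tree) : nat :=
  #|[set v : W | cls (graft T v T') == S]|.

Lemma graft_coef_iso (V1 V2 W1 W2 : finType) (T1 : rtree V1) (T2 : rtree V2)
    (T1' : rtree W1) (T2' : rtree W2) :
  iso T1 T2 -> iso T1' T2' -> graft_coef T1 T1' =1 graft_coef T2 T2'.
Proof.
case/isoP => f /is_isoP[[f' fK f'K] fr fa] /isoP[g /is_isoP[[g' gK g'K] gr ga]] S.
rewrite /graft_coef -(card_imset _ (can_inj gK)); apply: eq_card => w.
have -> : w = g (g' w) by rewrite g'K.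
rewrite mem_imset; last exact: can_inj gK.
rewrite !inE; congr (_ == S); apply/clsP/isoP.
pose F (x : V1 + W1) : V2 + W2 :=
  match x with inl y => inl (f y) | inr y => inr (g y) end.
pose G (x : V2 + W2) : V1 + W1 :=
  match x with inl y => inl (f' y) | inr y => inr (g' y) end.
have Ff x : (f x == root T2) = (x == root T1) by rewrite -fr (can_eq fK).
exists F; apply/is_isoP; split.
- by exists G => -[x|x] /=; rewrite ?fK ?f'K ?gK ?g'K.
- by rewrite !root_mk /= gr.
- by move=> [x|x] [y|y]; rewrite !adj_mk /= ?fa ?ga ?Ff ?(can_eq gK).
Qed.

Local Open Scope ring_scope.

(* A formal sum of rooted trees with coefficients in R is its coefficient
   function tree -> R, with R := K for \mathcal{T} and R := {poly K} for
   \mathcal{T}[t]. Since |T \curvearrowright T'| = |T| + |T'|, only the pairs of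
   trees with |T1| + |T2| = |S| contribute to the coefficient of S. *)
Definition prelie (R : comNzRingType) (A B : tree -> R) : tree -> R := fun S =>
  \sum_(m < (tree_size S).+1)
    \sum_(T1 : tree_of_size m) \sum_(T2 : tree_of_size (tree_size S - m))
      A (Tagged tree_of_size T1) * B (Tagged tree_of_size T2)
        *+ graft_coef (repr T1) (repr T2) S.

Section Umbral.
Variables (K : fieldType) (a : nat -> K).
Implicit Type q : {poly K}.

(* < g(D) | q >: the linear functional t^n |-> a_n *)
Definition umbral_functional q : K := \sum_(n < size q) q`_n * a n.

(* g(D) q, the linear operator t^n |-> \sum_j binom(n,j) a_(n-j) t^j *)
Definition umbral_operator q : {poly K} :=
  \sum_(n < size q) q`_n *: \sum_(j < n.+1) ('C(n, j)%:R * a (n - j)%N) *: 'X^j.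

(* \int_0^t q(tau) dtau *)
Definition integral0 q : {poly K} :=
  \sum_(n < size q) (q`_n / n.+1%:R) *: 'X^(n.+1).

(* The initial value problem P' = <g(D)|P> \curvearrowright P, P(0) = \bullet;
   the functional takes values in K, embedded into {poly K} as constants. *)
Definition is_solution (P : tree -> {poly K}) : Prop :=
  (forall S, (P S)^`() = prelie (fun T => (umbral_functional (P T))%:P) P S) /\
  (forall S, (P S).[0] = (S == cls bullet)%:R).

(* Here join (fun _ : 'I_1 => T) is {T | \bullet}. *)
Definition tree_relations (p : forall V : finType, rtree V -> {poly K}) : Prop :=
  [/\ p _ bullet = 1,
      forall (k : nat) (V : 'I_k -> finType) (T : forall i, rtree (V i)), (0 < k)%N ->
        p _ (join T) = \prod_(i < k) p _ (join (fun _ : 'I_1 => T i))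
    & forall (V : finType) (T : rtree V),
        p _ (join (fun _ : 'I_1 => T)) = integral0 (umbral_operator (p _ T))].

Definition iso_invariant (p : forall V : finType, rtree V -> {poly K}) : Prop :=
  forall (V W : finType) (T : rtree V) (T' : rtree W), iso T T' -> p _ T = p _ T'.

End Umbral.

Section PowerSeries.
Variable K : fieldType.

Definition fps_mul (u v : nat -> K) : nat -> K :=
  fun n => \sum_(i < n.+1) u i * v (n - i)%N.

Definition fps_X : nat -> K := fun n => (n == 1%N)%:R.

(* \sum_(k >= 0) a_k t^k / k! *)
Definition egf (a : nat -> K) : nat -> K := fun k => a k / k`!%:R.

(* \sum_(k >= 1) c_k t^k / k!; the value c_0 is ignored *)
Definition egf1 (c : nat -> K) : nat -> K := fun k => if k is 0%N then 0 else egf c k.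

End PowerSeries.

(* Main.v *)
(* Put p(S) = |Aut S| P(S) and alpha(S) = <g(D)|p(S)>. Counting isomorphisms from the
   trees T1 \searrow_w T2 to S in two ways turns the differential equation into a
   sum over the edges of S, each named by its lower end v:
     p(S)' = \sum_(v <> root) alpha(branch at v) p(trunk at v).
   Merge the root of {T | \bullet} with the root of T'. The edges of the resulting tree
   are the new edge, the edges of T and the edges of T'; by induction on the size,
   the formula is the product rule for p({T | \bullet}) p(T'), which gives (I).
   The same formula for {T | \bullet} reads
     p({T | \bullet})' = alpha(T) + \sum_(v <> root T) alpha(branch) p({trunk | \bullet}),
   and by induction both sides of p({T | \bullet})' = g(D) p(T) have the same derivative
   and the same value alpha(T) at 0, which gives (II). *)
From mathcomp Require Import all_boot all_order all_algebra perm.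
Require Import Defs.

Set Implicit Arguments.
Unset Strict Implicit.
Unset Printing Implicit Defensive.

Import GRing.Theory.
Local Open Scope ring_scope.

(** * The umbral functional, [g(D)], derivative and integral on polynomials *)

Section Umbral.
Variables (K : fieldType) (a : nat -> K).
Implicit Types q : {poly K}.

(** The defining sums stop at [size q]; a common bound [N] lets the sums for different polynomials
    be compared term by term. *)
Lemma sum_coef_widen (F : nat -> K) N q : (size q <= N)%N ->
  \sum_(n < size q) q`_n * F n = \sum_(n < N) q`_n * F n.
Proof.
move=> le; rewrite (big_ord_widen N (fun n => q`_n * F n) le) big_mkcond.
by apply: eq_bigr => n _; case: ltnP => // ge; rewrite nth_default ?mul0r.
Qed.

Lemma umbral_functionalZ x q :
  umbral_functional a (x *: q) = x * umbral_functional a q.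
Proof.
rewrite /umbral_functional (sum_coef_widen _ (size_scale_leq x q)) mulr_sumr.
by apply: eq_bigr => i _; rewrite coefZ mulrA.
Qed.

Lemma coef_umbral_operator N q j : (size q <= N)%N ->
  (umbral_operator a q)`_j = \sum_(n < N) q`_n * ('C(n, j)%:R * a (n - j)%N).
Proof.
move=> le; transitivity (\sum_(n < size q) q`_n * ('C(n, j)%:R * a (n - j)%N)).
  rewrite /umbral_operator coef_sum; apply: eq_bigr => n _; rewrite coefZ; congr (_ * _).
  rewrite -(poly_def n.+1 (fun j => 'C(n, j)%:R * a (n - j)%N)) coef_poly ltnS.
  by case: leqP => // lt; rewrite bin_small // mul0r.
exact: (sum_coef_widen (fun n => 'C(n, j)%:R * a (n - j)%N)).
Qed.

Lemma umbral_operatorD q1 q2 :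
  umbral_operator a (q1 + q2) = umbral_operator a q1 + umbral_operator a q2.
Proof.
apply/polyP => j; rewrite coefD !(@coef_umbral_operator (maxn (size q1) (size q2))) ?leq_max ?leqnn ?orbT //.
  by rewrite -big_split; apply: eq_bigr => n _; rewrite coefD mulrDl.
by rewrite -leq_max; exact: size_polyD.
Qed.

Lemma umbral_operatorZ x q : umbral_operator a (x *: q) = x *: umbral_operator a q.
Proof.
apply/polyP => j; rewrite coefZ !(@coef_umbral_operator (size q)) ?size_scale_leq // mulr_sumr.
by apply: eq_bigr => n _; rewrite coefZ mulrA.
Qed.

Lemma umbral_operator0 : umbral_operator a 0 = 0.
Proof. by rewrite /umbral_operator size_poly0 big_ord0. Qed.

Lemma umbral_operator_sum I (r : seq I) (p : pred I) (F : I -> {poly K}) :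
  umbral_operator a (\sum_(i <- r | p i) F i) = \sum_(i <- r | p i) umbral_operator a (F i).
Proof. exact: (big_morph _ umbral_operatorD umbral_operator0). Qed.

Lemma horner0_umbral_operator q : (umbral_operator a q).[0] = umbral_functional a q.
Proof.
rewrite horner_coef0 (coef_umbral_operator _ (leqnn _)).
by apply: eq_bigr => n _; rewrite bin0 mul1r subn0.
Qed.

(** [g(D)] is formally a series in [D], hence commutes with [D]. On coefficients this is the
    identity [(n+1) C(n,j) = (j+1) C(n+1,j+1)]. *)
Lemma deriv_umbral_operator q :
  (umbral_operator a q)^`() = umbral_operator a q^`().
Proof.
apply/polyP => j; rewrite coef_deriv (@coef_umbral_operator (size q).+1) //.
rewrite (@coef_umbral_operator (size q)); last first.
  exact: leq_trans (size_poly _ _) (leq_pred _).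
rewrite big_ord_recl mul0r mulr0 add0r -sumrMnl; apply: eq_bigr => n _.
rewrite coef_deriv lift0 subSS.
rewrite -[LHS]mulrnAr [RHS]mulrnAl -[RHS]mulrnAr; congr (_ * _).
rewrite -[LHS]mulrnAl -[RHS]mulrnAl -!mulrnA; congr (_%:R * _).
by rewrite mulnC -mul_bin_diag mulnC.
Qed.

Hypothesis K_char0 : [pchar K] =i pred0.

(** In characteristic zero differentiation loses only the constant term. The identities for the
    solution rest on this criterion. *)
Lemma poly_eq_deriv q1 q2 : q1^`() = q2^`() -> q1.[0] = q2.[0] -> q1 = q2.
Proof.
move=> ed; rewrite !horner_coef0 => e0; apply/polyP => -[//|j].
have /polyP/(_ j) := ed; rewrite !coef_deriv -[LHS]mulr_natr -[RHS]mulr_natr.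
by apply: mulIf; rewrite ((pcharf0P K).1 K_char0).
Qed.

Lemma deriv_integral0 q : (integral0 q)^`() = q.
Proof.
rewrite /integral0 raddf_sum /= -[RHS]coefK poly_def; apply: eq_bigr => n _.
by rewrite derivZ derivXn -scaler_nat scalerA divfK // ((pcharf0P K).1 K_char0).
Qed.

Lemma horner0_integral0 q : (integral0 q).[0] = 0.
Proof.
by rewrite /integral0 horner_sum big1 // => n _; rewrite hornerZ hornerXn exprS mul0r mulr0.
Qed.

End Umbral.

(** * Counting isomorphisms of rooted trees *)

Section Isomorphisms.
Variables (V W : finType).
Implicit Types (T : rtree V) (S : rtree W).

Lemma is_isoI T S (f : V -> W) : injective f -> (forall w, exists x, w = f x) ->
  f (root T) = root S -> (forall x y, adj S (f x) (f y) = adj T x y) -> is_iso T S f.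
Proof.
move=> fi fs fr fa; apply/and4P; split; first exact/injectiveP.
- by apply/forallP => w; have [x ->] := fs w; exact: codom_f.
- exact/eqP.
- by apply/forallP => x; apply/forallP => y; apply/eqP.
Qed.

Lemma iso_card T S : iso T S -> #|V| = #|W|.
Proof. by case/isoP => f /is_isoP[/bij_eq_card]. Qed.

Lemma is_iso_ext T S (f g : V -> W) : f =1 g -> is_iso T S f -> is_iso T S g.
Proof.
move=> fg /is_isoP[fb fr fa]; apply/is_isoP; split.
- exact: eq_bij fb _ fg.
- by rewrite -fg.
- by move=> x y; rewrite -!fg.
Qed.

Lemma is_iso_inv T S f : is_iso T S f ->
  exists g : W -> V, [/\ cancel f g, cancel g f & is_iso S T g].
Proof.
case/is_isoP => [[g fK gK] fr fa]; exists g; split => //.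
apply/is_isoP; split; first by exists f.
- by rewrite -fr fK.
- by move=> x y; rewrite -fa !gK.
Qed.

Definition isos T S : {set {ffun V -> W}} := [set f : {ffun V -> W} | is_iso T S f].

End Isomorphisms.

Lemma is_iso_comp (U V W : finType) (R : rtree U) (T : rtree V) (S : rtree W) f g :
  is_iso R T f -> is_iso T S g -> is_iso R S (g \o f).
Proof.
case/is_isoP => fb fr fa /is_isoP[gb gr ga]; apply/is_isoP; split.
- exact: bij_comp.
- by rewrite /= fr.
- by move=> x y; rewrite /= ga.
Qed.

(** Composition with one fixed isomorphism is a bijection from [Aut S] onto all isomorphisms; if
    there is none, both sides vanish. *)
Lemma card_isos (V W : finType) (T : rtree V) (S : rtree W) :
  #|isos T S| = (iso T S * #|Aut S|)%N.
Proof.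
have [/isoP[f Hf]|nTS] := boolP (iso T S); last first.
  rewrite mul0n; apply/eqP; rewrite cards_eq0 -subset0; apply/subsetP => f.
  by rewrite inE => Hf; case/isoP: nTS; exists f.
have [g [fK gK Hg]] := is_iso_inv Hf.
rewrite mul1n -(card_imset (mem (Aut S)) (f := fun s : {perm W} => [ffun x => s (f x)])).
  apply: eq_card => h; apply/idP/imsetP => [|[s]]; rewrite !inE => Hh.
    have Hhg := is_iso_comp Hg Hh.
    have /is_isoP[/bij_inj hi _ _] := Hhg.
    exists (perm hi); last by apply/ffunP => x; rewrite ffunE permE /= fK.
    by rewrite inE; apply: is_iso_ext Hhg => x; rewrite permE.
  by move=> ->; apply: is_iso_ext (is_iso_comp Hf Hh) => x; rewrite ffunE.
move=> s t /ffunP st; apply/permP => y.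
by have := st (g y); rewrite !ffunE gK.
Qed.

(** * Isomorphisms between grafted trees *)

Definition sum_map (A B C D : Type) (f : A -> C) (g : B -> D) (z : A + B) : C + D :=
  match z with inl x => inl (f x) | inr y => inr (g y) end.

Section GraftIso.
Variables (V W V' W' : finType).
Variables (T1 : rtree V) (w : W) (T2 : rtree W) (A : rtree V') (w' : W') (B : rtree W').

Lemma graft_is_iso f g : is_iso T1 A f -> is_iso T2 B g -> g w = w' ->
  is_iso (graft T1 w T2) (graft A w' B) (sum_map f g).
Proof.
case/is_isoP => [[f' fK f'K] fr fa] /is_isoP[[g' gK g'K] gr ga] gw.
apply/is_isoP; split.
- by exists (sum_map f' g') => -[x|x] /=; rewrite ?fK ?f'K ?gK ?g'K.
- by rewrite !root_mk /= gr.
- move=> [x|x] [y|y]; rewrite !adj_mk /= ?fa ?ga //.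
    by rewrite -fr -gw (can_eq fK) (can_eq gK).
  by rewrite -fr -gw (can_eq fK) (can_eq gK).
Qed.

(* The trunk is what remains connected to the root once the root of the grafted
   tree is removed. *)
Lemma graft_iso_trunk h : is_iso (graft T1 w T2) (graft A w' B) h ->
  h (inl (root T1)) = inl (root A) -> forall y, exists z, h (inr y) = inr z.
Proof.
case/is_isoP => hb hr ha hv y.
have /and4P[_ _ /forallP/(_ (root T2))/forallP/(_ y) con _] := adj_tree T2.
case/connectP: con => p; elim/last_ind: p y => [|p z IHp] y /=.
  by move=> _ ->; exists (root B); rewrite -[inr (root T2)](root_mk _ (graft_tree T1 w T2)) hr.
rewrite rcons_path last_rcons => /andP[/IHp{}IHp exy] ->.
have [u hu] := IHp _ erefl.
have := ha (inr (last (root T2) p)) (inr z); rewrite !adj_mk /= exy hu.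
(* The only edge from the trunk to an [inl x] has [x = root A], but that vertex is already the image
   of [inl (root T1)]. *)
case hz: (h (inr z)) => [x|x]; last by exists x.
move/andP => [/eqP xE _]; subst x.
by have := bij_inj hb; move=> /(_ (inr z) (inl (root T1))); rewrite hz hv => /(_ erefl).
Qed.
End GraftIso.

(** By [graft_iso_trunk], [h] and its inverse both map trunk into trunk, so they also map grafted
    part to grafted part. The joining edge then forces [g w = w']. *)
Lemma graft_iso_split (V W V' W' : finType) (T1 : rtree V) (w : W) (T2 : rtree W)
    (A : rtree V') (w' : W') (B : rtree W') h :
  is_iso (graft T1 w T2) (graft A w' B) h -> h (inl (root T1)) = inl (root A) ->
  exists f g, [/\ h =1 sum_map f g, is_iso T1 A f, is_iso T2 B g & g w = w'].
Proof.
move=> Hh hv; have [k [hK kK Hk]] := is_iso_inv Hh.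
have kv : k (inl (root A)) = inl (root T1) by rewrite -hv hK.
have [g gE] := fin_all_exists (graft_iso_trunk Hh hv).
have [g' g'E] := fin_all_exists (graft_iso_trunk Hk kv).
have hl x : exists z, h (inl x) = inl z.
  case hx: (h (inl x)) => [z|z]; first by exists z.
  by have := g'E z; rewrite -hx hK.
have kl x : exists z, k (inl x) = inl z.
  case kx: (k (inl x)) => [z|z]; first by exists z.
  by have := gE z; rewrite -kx kK.
have [f fE] := fin_all_exists hl; have [f' f'E] := fin_all_exists kl.
have /is_isoP[_ hr ha] := Hh.
have gK : cancel g g' by move=> y; have := hK (inr y); rewrite gE g'E => -[].
have g'K : cancel g' g by move=> y; have := kK (inr y); rewrite g'E gE => -[].
have fK : cancel f f' by move=> y; have := hK (inl y); rewrite fE f'E => -[].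
have f'K : cancel f' f by move=> y; have := kK (inl y); rewrite f'E fE => -[].
exists f, g; split.
- by case=> x.
- apply/is_isoP; split; first by exists f'.
    by move: hv; rewrite fE => -[].
  by move=> x y; have := ha (inl x) (inl y); rewrite !fE !adj_mk.
- apply/is_isoP; split; first by exists g'.
    by move: hr; rewrite !root_mk gE => -[].
  by move=> x y; have := ha (inr x) (inr y); rewrite !gE !adj_mk.
- have := ha (inl (root T1)) (inr w); rewrite hv gE !adj_mk /= !eqxx /=.
  by move/eqP.
Qed.

Lemma graft_iso (V W V' W' : finType) (T1 : rtree V) (T2 : rtree W)
    (A : rtree V') (B : rtree W') :
  iso T1 A -> iso T2 B -> iso (graft T1 (root T2) T2) (graft A (root B) B).
Proof.
case/isoP => f Hf /isoP[g Hg]; apply/isoP; exists (sum_map f g).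
by apply: graft_is_iso => //; case/is_isoP: Hg.
Qed.

(** * Cutting a tree above a vertex into branch and trunk *)

Section Cut.
Variables (V : finType) (T : rtree V).
Let r := root T.
Let rank := tree_ranked (root T) (adj_tree T).

Definition parent (x : V) : V := (sval rank).1 x.
Definition height (x : V) : nat := (sval rank).2 x.

Lemma height_parent x : x != r -> (height (parent x) < height x)%N.
Proof. by have /andP[/forallP/(_ x)/implyP] := svalP rank. Qed.

Lemma adj_parent x y :
  adj T x y = ((x != r) && (parent x == y)) || ((y != r) && (parent y == x)).
Proof. by have /andP[_ /forallP/(_ x)/forallP/(_ y)/eqP] := svalP rank. Qed.

(** The parent map restricts to a parent map with root [u]: every other vertex of [Q] keeps its
    parent in [Q], and the second hypothesis rules out an edge from [u] up to its old parent inside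
    [Q]. This serves both pieces of a cut. *)
Lemma subtree_tree (Q : pred V) (u : {x | Q x}) :
  (forall x, Q x -> x != val u -> (x != r) && Q (parent x)) ->
  (val u != r -> ~~ Q (parent (val u))) ->
  is_tree (relpre (val : {x | Q x} -> V) (adj T)).
Proof.
move=> up uQ.
(* [insubd] falls back on [u] when the parent lies outside [Q]; this can happen only at the new root
   [u], whose parent is irrelevant. *)
apply: (@ranked_tree _ _ u ([ffun x => insubd u (parent (val x))],
                            [ffun x => height (val x)])).
apply/andP; split.
  apply/forallP => x; apply/implyP => xu; rewrite !ffunE.
  have /andP[xr Qx] := up _ (valP x) xu.
  by rewrite val_insubd Qx height_parent.
have E (x y : {x | Q x}) : (val x != r) && (parent (val x) == val y) =
    (x != u) && (insubd u (parent (val x)) == y).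
  have [->|xu] := eqVneq x u.
    apply/negbTE/negP => /andP[/uQ nQ /eqP yE].
    by rewrite yE (valP y) in nQ.
  have /andP[xr Qx] := up _ (valP x) xu.
  by rewrite xr -val_eqE val_insubd Qx.
apply/forallP => x; apply/forallP => y; rewrite !ffunE /= adj_parent.
by rewrite (E x y) (E y x).
Qed.

Variable v : V.

(** Reachability along parent steps that stop at the root; [v] counts as below itself. *)
Definition below (x : V) : bool :=
  connect [rel y z | (y != r) && (parent y == z)] x v.

(* The root is kept unconditionally, so that the trunk is a tree even for the
   degenerate cut at [v = r]. *)
Definition above (x : V) : bool := (x == r) || ~~ below x.

Lemma belowv : below v.
Proof. exact: connect0. Qed.

Lemma above_root : above r.
Proof. by rewrite /above eqxx. Qed.

Lemma below_parent x : x != v -> below x = (x != r) && below (parent x).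
Proof.
move=> xv; apply/idP/andP => [/connectP[[|y p] /=]|[xr Bx]].
- by move=> _ vx; rewrite vx eqxx in xv.
- by case/andP => /andP[xr /eqP->] yp vE; split=> //; apply/connectP; exists p.
- by apply: connect_trans Bx; apply: connect1; rewrite /= xr eqxx.
Qed.

Lemma below_height x : below x -> (height v <= height x)%N.
Proof.
case/connectP => p; elim: p x => [|y p IHp] x /=; first by move=> _ ->.
case/andP => /andP[xr /eqP yE] yp vE; apply: leq_trans (IHp _ yp vE) _.
by rewrite -yE ltnW // height_parent.
Qed.

Lemma parentv_not_below : v != r -> ~~ below (parent v).
Proof.
by move=> vr; apply/negP => /below_height; rewrite leqNgt height_parent.
Qed.

Lemma branch_tree : is_tree (relpre (val : {x | below x} -> V) (adj T)).
Proof.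
apply: (@subtree_tree below (exist _ v belowv)) => [x Bx xv|] /=.
  by rewrite -below_parent.
exact: parentv_not_below.
Qed.

Lemma trunk_tree : is_tree (relpre (val : {x | above x} -> V) (adj T)).
Proof.
apply: (@subtree_tree above (exist _ r above_root)) => [x Ax xr|] /=; last by rewrite eqxx.
have nB : ~~ below x by move: Ax; rewrite /above (negbTE xr).
rewrite xr /above; apply/orP; right; apply: contra nB => Bp.
have [->|xv] := eqVneq x v; first exact: belowv.
by rewrite below_parent // xr Bp.
Qed.

Definition branch : rtree {x | below x} := mk_rtree (exist _ v belowv) branch_tree.
Definition trunk : rtree {x | above x} := mk_rtree (exist _ r above_root) trunk_tree.

Hypothesis vr : v != r.

Lemma aboveN x : above x = ~~ below x.
Proof.
rewrite /above; case: eqVneq => //= ->.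
by rewrite below_parent ?eqxx // eq_sym.
Qed.

Lemma above_parentv : above (parent v).
Proof. by rewrite aboveN parentv_not_below. Qed.

(** A non-root vertex other than [v] is below [v] exactly when its parent is, so only the edge above
    [v] crosses the cut. *)
Lemma adj_below x y : below x -> ~~ below y ->
  adj T x y = (x == v) && (y == parent v).
Proof.
move=> Bx nBy; have yv : y != v by apply: contraNneq nBy => ->; exact: belowv.
have -> : adj T x y = (x != r) && (parent x == y).
  rewrite adj_parent orbC; case: andP => // -[yr /eqP yx].
  by rewrite below_parent // yr yx Bx in nBy.
have [->|xv] := eqVneq x v; first by rewrite vr eq_sym.
apply/negbTE; apply: contra nBy => /andP[_ /eqP<-].
by move: Bx; rewrite below_parent // => /andP[].
Qed.

Definition cut_point : {x | above x} := exist _ (parent v) above_parentv.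

Definition uncut (z : {x | below x} + {x | above x}) : V :=
  match z with inl x => val x | inr y => val y end.

(** [below] and [above] partition the vertices, adjacency inside each piece is restricted from [T],
    and [adj_below] accounts for the one remaining edge. *)
Lemma uncut_is_iso :
  is_iso (graft branch cut_point trunk) T uncut.
Proof.
apply: is_isoI => [[x|x] [y|y] /= E|x||].
- by congr inl; exact: val_inj.
- by have := valP x; rewrite /= E; have := valP y; rewrite /= aboveN => /negbTE->.
- by have := valP y; rewrite /= -E; have := valP x; rewrite /= aboveN => /negbTE->.
- by congr inr; exact: val_inj.
- have [Bx|nBx] := boolP (below x); first by exists (inl (exist _ x Bx)).
  by have Ax : above x; [rewrite aboveN | exists (inr (exist _ x Ax))].
- by rewrite root_mk.
have E (x : {x | below x}) (y : {x | above x}) :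
    adj T (val x) (val y) = (x == root branch) && (y == cut_point).
  by rewrite adj_below ?(valP x) // -aboveN (valP y).
have sym x y : adj T x y = adj T y x.
  by rewrite !adj_parent orbC.
case=> [x|x] [y|y]; rewrite adj_mk /=.
- by rewrite adj_mk.
- exact: E.
- by rewrite sym; exact: E.
- by rewrite adj_mk.
Qed.

Lemma cut_card : (#|{: {x | below x}}| + #|{: {x | above x}}|)%N = #|V|.
Proof.
by have /is_isoP[/bij_eq_card <- _ _] := uncut_is_iso; rewrite card_sum.
Qed.

Lemma trunk_lt : (#|{: {x | above x}}| < #|V|)%N.
Proof.
rewrite -cut_card -[X in (X < _)%N]add0n ltn_add2r; apply/card_gt0P.
by exists (exist _ v belowv).
Qed.

End Cut.

(** * Uniqueness of cuts and double counting of graftings *)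

Lemma graft_root_neq (V W X : finType) (T1 : rtree V) (w : W) (T2 : rtree W) (S : rtree X) h :
  is_iso (graft T1 w T2) S h -> h (inl (root T1)) != root S.
Proof.
case/is_isoP => hb hr _; apply/eqP => E.
by have := bij_inj hb (etrans E (esym hr)).
Qed.

(** Cutting undoes grafting: [h] followed by the inverse of [uncut] is an isomorphism of grafts that
    matches the grafted roots, and [graft_iso_split] separates it. *)
Lemma cut_unique (V W X : finType) (T1 : rtree V) (w : W) (T2 : rtree W) (S : rtree X) h v :
  is_iso (graft T1 w T2) S h -> h (inl (root T1)) = v ->
  iso T1 (branch S v) /\ iso T2 (trunk S v).
Proof.
move=> Hh hv; have vr : v != root S by rewrite -hv; exact: graft_root_neq Hh.
have [k [uK kK Hk]] := is_iso_inv (uncut_is_iso vr).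
have [|f [g [_ Hf Hg _]]] := graft_iso_split (is_iso_comp Hh Hk).
  by rewrite /= hv -[v]/(uncut (inl (root (branch S v)))) uK.
by split; apply/isoP; [exists f | exists g].
Qed.

Lemma cut_graft (V W : finType) (A : rtree V) (w : W) (B : rtree W) :
  iso A (branch (graft A w B) (inl (root A))) /\ iso B (trunk (graft A w B) (inl (root A))).
Proof.
by apply: (@cut_unique _ _ _ _ w _ _ id) => //; apply/is_isoP; split => //; exists id.
Qed.

(** The map [F] glues a pair of isomorphisms along the cut edge; [graft_iso_split] shows that every
    [h] with the prescribed image arises in this way. *)
Lemma card_isos_cut (V W X : finType) (T1 : rtree V) (w : W) (T2 : rtree W) (S : rtree X)
    (v : X) (vr : v != root S) :
  #|[set h in isos (graft T1 w T2) S | h (inl (root T1)) == v]| =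
  #|[set fg in setX (isos T1 (branch S v)) (isos T2 (trunk S v)) | fg.2 w == cut_point vr]|.
Proof.
pose F (fg : {ffun V -> {x | below S v x}} * {ffun W -> {x | above S v x}}) :
    {ffun V + W -> X} := [ffun z => uncut (sum_map fg.1 fg.2 z)].
have Hu := uncut_is_iso vr.
have [k [uK kK Hk]] := is_iso_inv Hu.
have F_inj : injective F.
  move=> [f g] [f' g'] /ffunP E; congr (_, _); apply/ffunP => x.
    by have := E (inl x); rewrite !ffunE => /(can_inj uK) [].
  by have := E (inr x); rewrite !ffunE => /(can_inj uK) [].
rewrite -[RHS](card_imset _ F_inj).
apply: eq_card => h; apply/idP/imsetP => [|[[f g]]]; rewrite !inE.
  case/andP => Hh /eqP hv.
  have [|f [g [E Hf Hg gw]]] := graft_iso_split (is_iso_comp Hh Hk).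
    by rewrite /= hv -[v]/(uncut (inl (root (branch S v)))) uK.
  exists (finfun f, finfun g).
    rewrite !inE /= ffunE gw eqxx andbT; apply/andP; split.
      by apply: is_iso_ext Hf => x; rewrite ffunE.
    by apply: is_iso_ext Hg => x; rewrite ffunE.
  apply/ffunP => z; rewrite ffunE; have := E z; rewrite /= => Ez.
  by rewrite -[h z]kK Ez; case: z {Ez} => x /=; rewrite ffunE.
case/andP => /andP[Hf Hg] /eqP gw ->; have /is_isoP[_ fr _] := Hf.
apply/andP; split; last by rewrite ffunE /= fr root_mk.
apply: is_iso_ext (is_iso_comp (graft_is_iso Hf Hg gw) Hu) => z.
by rewrite ffunE.
Qed.

(* Double counting of the isomorphisms from the trees [graft T1 w T2] to [S], sorted
   by the image [v] of the root of [T1]. *)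
Lemma graft_coef_cut (V W X : finType) (T1 : rtree V) (T2 : rtree W) (S : rtree X) :
  (graft_coef T1 T2 (cls S) * #|Aut S| =
   \sum_(v | v != root S) #|isos T1 (branch S v)| * #|isos T2 (trunk S v)|)%N.
Proof.
transitivity (\sum_w #|isos (graft T1 w T2) S|)%N.
  rewrite /graft_coef -sum1_card big_distrl big_mkcond /=; apply: eq_bigr => w _.
  rewrite inE card_isos; have -> : iso (graft T1 w T2) S = (cls (graft T1 w T2) == cls S).
    by apply/clsP/eqP.
  by case: eqP.
transitivity (\sum_w \sum_(v | v != root S)
    #|[set h in isos (graft T1 w T2) S | h (inl (root T1)) == v]|)%N.
  apply: eq_bigr => w _; rewrite -sum1_card.
  rewrite (partition_big (fun h : {ffun V + W -> X} => h (inl (root T1)))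
             (fun v => v != root S)) /=.
    apply: eq_bigr => v _; rewrite -sum1_card; apply: eq_bigl => h.
    by rewrite !inE.
  by move=> h; rewrite inE; exact: graft_root_neq.
rewrite exchange_big; apply: eq_bigr => v vr.
rewrite -cardsX -sum1_card.
under eq_bigr => w _ do rewrite (card_isos_cut _ _ _ vr) -sum1_card.
under eq_bigr => w _ do under eq_bigl => fg do rewrite inE.
rewrite (exchange_big_dep (mem (setX (isos T1 (branch S v)) (isos T2 (trunk S v))))) /=;
  last by move=> w fg _ /andP[].
apply: eq_bigr => -[f g] /= Hfg; rewrite sum1_card.
(* For each pair [(f, g)] exactly one attaching vertex [w] qualifies: the preimage of [cut_point vr]
   under [g]. *)
have /is_isoP[[g' gK g'K] _ _] : is_iso T2 (trunk S v) g.
  by move: Hfg; rewrite !inE => /andP[].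
rewrite -(card1 (g' (cut_point vr))); apply: eq_card => w.
move: Hfg; rewrite !inE /= => ->.
by rewrite unfold_in /= -{1}[cut_point vr]g'K (can_eq gK).
Qed.

(** * The pre-Lie product as a sum over cuts *)

Section Derivative.
Variable R : comNzRingType.
Implicit Types F G : tree -> R.

Lemma iso_repr n (S : tree_of_size n) (V : finType) (T : rtree V) :
  iso (repr S) T = (Tagged tree_of_size S == cls T).
Proof. by rewrite -[S in RHS]reprK -cls_ord; apply/clsP/eqP. Qed.

Lemma sum_tree_of_size m F t :
  \sum_(S : tree_of_size m) F (Tagged tree_of_size S) *+ (Tagged tree_of_size S == t) =
  F t *+ (m == tree_size t).
Proof.
case: t => n t; rewrite /tree_size /=; have [nm|nm] := eqVneq m n; last first.
  rewrite mulr0n big1 // => S _; case: eqP => // /(congr1 tag) /= E.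
  by rewrite E eqxx in nm.
subst n; rewrite (bigD1 t) //= eqxx big1 ?addr0 // => S nS.
by rewrite eq_Tagged /= (negbTE nS).
Qed.

(** Multiplication by [#|Aut T|] produces the counts of [graft_coef_cut]. By [card_isos] only the
    classes of the branch and the trunk contribute, each with its number of automorphisms. *)
Lemma prelie_cut F G (V : finType) (T : rtree V) :
  prelie F G (cls T) *+ #|Aut T| =
  \sum_(v | v != root T) (F (cls (branch T v)) *+ #|Aut (branch T v)|) *
                         (G (cls (trunk T v)) *+ #|Aut (trunk T v)|).
Proof.
rewrite /prelie -sumrMnl.
under eq_bigr => m _.
  rewrite -sumrMnl; under eq_bigr => T1 _.
    rewrite -sumrMnl; under eq_bigr => T2 _.
      rewrite -mulrnA graft_coef_cut -sumrMnr.
      over.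
    rewrite exchange_big /=.
    over.
  rewrite exchange_big /=.
  over.
rewrite exchange_big; apply: eq_bigr => v vr.
set br := branch T v; set tr := trunk T v.
set a := #|Aut br|; set b := #|Aut tr|.
transitivity (\sum_(m < #|V|.+1)
  ((F (cls br) *+ a) *+ (m == tree_size (cls br) :> nat)) *
  ((G (cls tr) *+ b) *+ ((#|V| - m)%N == tree_size (cls tr)))).
  apply: eq_bigr => m _.
  rewrite -(sum_tree_of_size _ (fun t => F t *+ a)) mulr_suml; apply: eq_bigr => T1 _.
  rewrite -(sum_tree_of_size _ (fun t => G t *+ b)) mulr_sumr; apply: eq_bigr => T2 _.
  rewrite !card_isos !iso_repr -/a -/b.
  do 2!case: eqP => _; rewrite ?mul0n ?muln0 ?mulr0n ?mul0r ?mulr0 //.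
  by rewrite !mul1n !mulr1n mulrnAl mulrnAr -mulrnA mulnC.
have szE := cut_card vr.
have lt : (tree_size (cls br) < #|V|.+1)%N.
  by rewrite ltnS -szE; exact: leq_addr.
(* Only [m] equal to the size of the branch survives; [#|V| - m] is then the size of the trunk. *)
rewrite (bigD1 (Ordinal lt)) //= big1 => [|m].
  by rewrite eqxx -[X in (X - _)%N]szE addKn eqxx addr0.
by rewrite -val_eqE /= => /negbTE->; rewrite mulr0n mul0r.
Qed.

End Derivative.

Lemma is_iso_id (V : finType) (T : rtree V) : is_iso T T id.
Proof. by apply/is_isoP; split => //; exists id. Qed.

(** * Regrouping iterated graftings, and the cuts of a grafted tree *)

Section GraftAssociativity.
Variables (U V W : finType) (A : rtree U) (B : rtree V) (C : rtree W).

Definition regroup_left (z : U + (V + W)) : (U + V) + W :=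
  match z with
  | inl x => inl (inl x) | inr (inl y) => inl (inr y) | inr (inr z) => inr z
  end.

(** Associativity case, where [A] is attached to [B]. It locates the cuts at edges inside the
    grafted tree. *)
Lemma graft_regroup_left v w :
  is_iso (graft A (inl v) (graft B w C)) (graft (graft A v B) w C) regroup_left.
Proof.
apply: is_isoI => [[x|[x|x]] [y|[y|y]] //= [->] //|||].
- case=> [[x|x]|x]; by [exists (inl x) | exists (inr (inl x)) | exists (inr (inr x))].
- by rewrite !root_mk.
- by case=> [x|[x|x]] [y|[y|y]]; rewrite !adj_mk /= ?adj_mk //= ?andbF.
Qed.

Definition regroup_right (z : U + (V + W)) : V + (U + W) :=
  match z with
  | inl x => inr (inl x) | inr (inl y) => inl y | inr (inr z) => inr (inr z)
  end.

(** Commutation case, where [A] and [B] are both attached to [C]. It locates the cuts at edges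
    inside the receiving tree. *)
Lemma graft_regroup_right v w :
  is_iso (graft A (inr v) (graft B w C)) (graft B (inr w) (graft A v C)) regroup_right.
Proof.
apply: is_isoI => [[x|[x|x]] [y|[y|y]] //= [->] //|||].
- case=> [x|[x|x]]; by [exists (inl x) | exists (inr (inl x)) | exists (inr (inr x))].
- by rewrite !root_mk.
- by case=> [x|[x|x]] [y|[y|y]]; rewrite !adj_mk /= ?adj_mk //= ?andbF.
Qed.
End GraftAssociativity.

Section CutGraft.
Variables (V W : finType) (T : rtree V) (T' : rtree W).

(** Regluing [T] from its pieces and regrouping exhibits the graft as [branch T x] attached to
    [graft (trunk T x) u T']; [cut_unique] then identifies both pieces. *)
Lemma cut_graft_left u x : x != root T ->
  iso (branch T x) (branch (graft T u T') (inl x)) /\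
  iso (graft (trunk T x) u T') (trunk (graft T u T') (inl x)).
Proof.
move=> xr; have Hi := graft_is_iso (uncut_is_iso xr) (is_iso_id T') (erefl u).
exact: (cut_unique (is_iso_comp (graft_regroup_left _ _ _ _ _) Hi)).
Qed.

Lemma cut_graft_right y : y != root T' ->
  iso (branch T' y) (branch (graft T (root T') T') (inr y)) /\
  iso (graft T (root (trunk T' y)) (trunk T' y)) (trunk (graft T (root T') T') (inr y)).
Proof.
move=> yr; have rE : @uncut _ T' y (inr (root (trunk T' y))) = root T' by rewrite root_mk.
have Hi := graft_is_iso (is_iso_id T) (uncut_is_iso yr) rE.
exact: (cut_unique (is_iso_comp (graft_regroup_right _ _ _ _ _) Hi)).
Qed.

(** Non-root vertices index edges: [inl (root T)] the new edge, every other [inl x] an edge of [T],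
    and [inr y] an edge of [T']. *)
Lemma sum_cut_graft (R : nmodType) (F : tree -> tree -> R) (S := graft T (root T') T') :
  \sum_(v | v != root S) F (cls (branch S v)) (cls (trunk S v)) =
  F (cls T) (cls T')
  + \sum_(x | x != root T) F (cls (branch T x)) (cls (graft (trunk T x) (root T') T'))
  + \sum_(y | y != root T')
      F (cls (branch T' y)) (cls (graft T (root (trunk T' y)) (trunk T' y))).
Proof.
rewrite big_sumType /=; congr (_ + _); last first.
  rewrite root_mk; apply: eq_big => // y yr.
  by have [/clsP-> /clsP->] := cut_graft_right yr.
rewrite (eq_bigl xpredT) // (bigD1 (root T)) //=; congr (_ + _).
  by have [/clsP-> /clsP->] := cut_graft T (root T') T'.
by apply: eq_bigr => x xr; have [/clsP-> /clsP->] := cut_graft_left (root T') xr.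
Qed.
End CutGraft.

(** * Joins as iterated graftings at the root *)

Section Joins.

Lemma join_iso k (V W : 'I_k -> finType) (T : forall i, rtree (V i)) (S : forall i, rtree (W i)) :
  (forall i, iso (T i) (S i)) -> iso (join T) (join S).
Proof.
move=> TS; have /fin_all_exists[f Hf] i : exists f, is_iso (T i) (S i) f.
  exact/isoP.
have /fin_all_exists[g Hg] i : exists g, [/\ cancel (f i) g, cancel g (f i) & is_iso (S i) (T i) g].
  exact: is_iso_inv.
apply/isoP; exists (omap (fun z => Tagged W (f (tag z) (tagged z)))).
apply/is_isoP; split => [||[[i x]|] [[j y]|]] //.
- exists (omap (fun z => Tagged V (g (tag z) (tagged z)))) => -[[i x]|] //=.
    by have [->] := Hg i.
  by have [_ ->] := Hg i.
- rewrite !adj_mk /=; have [ij|//] := eqVneq i j; subst j.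
  by rewrite !tagged_asE; have /is_isoP[_ _ ->] := Hf i.
- rewrite !adj_mk /=; have /is_isoP[fb <- _] := Hf i.
  by rewrite (bij_eq fb).
- rewrite !adj_mk /=; have /is_isoP[fb <- _] := Hf j.
  by rewrite (bij_eq fb).
- by rewrite !adj_mk.
Qed.

Lemma join0 (V : 'I_0 -> finType) (T : forall i, rtree (V i)) : iso (join T) bullet.
Proof.
apply/isoP; exists (fun=> tt); apply: is_isoI => [|[]||] //.
- by move=> [[[]]|] // [[[]]|].
- by exists None.
- by move=> [[[]]|] // [[[]]|]; rewrite !adj_mk.
Qed.

(** Peeling off the first branch turns statements about joins into inductions over root
    graftings. *)
Lemma joinS k (V : 'I_k.+1 -> finType) (T : forall i, rtree (V i))
    (J := join (fun i => T (lift ord0 i))) :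
  iso (graft (T ord0) (root J) J) (join T).
Proof.
pose f (z : V ord0 + option {i & V (lift ord0 i)}) : option {i & V i} :=
  match z with
  | inl x => Some (Tagged V x)
  | inr (Some y) => Some (Tagged V (tagged y : V (lift ord0 (tag y))))
  | inr None => None
  end.
have neq i : (lift ord0 i == ord0 :> 'I_k.+1) = false.
  by rewrite eq_sym (negbTE (neq_lift _ _)).
apply/isoP; exists f; apply: is_isoI => [z z' E|||].
- apply/eqP; move: z z' E => [x|[[i x]|]] [y|[[j y]|]] //= /Some_inj E.
  + by move/eqP: E; rewrite eq_Tagged /= => /eqP->.
  + have /lift_inj ij := congr1 tag E; subst j.
    by move/eqP: E; rewrite eq_Tagged /= => /eqP->.
- case=> [[i x]|]; last by exists (inr None).
  case: (unliftP ord0 i) x => [j ->|->] x; last by exists (inl x).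
  by exists (inr (Some (Tagged (fun i => V (lift ord0 i)) x))).
- by [].
- case=> [x|[[i x]|]] [y|[[j y]|]]; rewrite !adj_mk //= ?adj_mk /= ?neq ?andbF ?andbT //.
  + by rewrite tagged_asE.
  + rewrite (inj_eq (@lift_inj _ _)); have [ij|//] := eqVneq i j; subst j.
    by rewrite !tagged_asE.
Qed.

Lemma join1 (V : finType) (T : rtree V) :
  iso (graft T (root bullet) bullet) (join (fun _ : 'I_1 => T)).
Proof.
apply: iso_trans (joinS _); apply: graft_iso (iso_refl T) _.
by rewrite iso_sym; exact: join0.
Qed.

Lemma card1_bullet (V : finType) (T : rtree V) : (#|V| <= 1)%N -> iso T bullet.
Proof.
move=> /card_le1_eqP V1; apply/isoP; exists (fun=> tt); apply: is_isoI => [x y _|[]||x y] //.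
- exact: V1.
- by exists (root T).
- rewrite adj_mk; have -> : y = x by exact: V1.
  by have /and4P[/forallP/(_ x)/negbTE-> _ _ _] := adj_tree T.
Qed.

(** A tree with more than one vertex splits into the branch at a child of the root and a smaller
    trunk, so induction and [joinS] apply. *)
Lemma iso_join (V : finType) (T : rtree V) :
  exists k (W : 'I_k -> finType) (S : forall i, rtree (W i)), iso T (join S).
Proof.
have [n] := ubnP #|V|; elim: n V T => // n IHn V T; rewrite ltnS => le.
have [V1|V1] := leqP #|V| 1%N.
  exists 0%N, (fun=> unit : finType), (fun=> bullet).
  by apply: iso_trans (card1_bullet T V1) _; rewrite iso_sym; exact: join0.
have [x0 x0r] : exists x, x != root T.
  have [x [y [_ _ xy]]] := card_gt1P V1.
  have [xr|xr] := eqVneq x (root T); last by exists x.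
  by exists y; rewrite -xr eq_sym.
(* A non-root vertex of minimal height is a child of the root, since its parent is strictly lower in
   height. *)
case: (arg_minnP (height T) (P := fun x => x != root T) x0r) => v vr vmin.
have pv : parent T v = root T.
  apply/eqP/negPn/negP => /vmin; rewrite leqNgt.
  by rewrite height_parent.
have iT : iso (graft (branch T v) (root (trunk T v)) (trunk T v)) T.
  have -> : root (trunk T v) = cut_point vr by apply: val_inj; rewrite root_mk /= pv.
  by apply/isoP; exists (@uncut _ T v); exact: uncut_is_iso.
have [k [W [S iS]]] := IHn _ (trunk T v) (leq_trans (trunk_lt vr) le).
(* The vertex type depends on the index, so type and tree are packed together before the case
   distinction. *)
pose F (i : 'I_k.+1) : {W : finType & rtree W} :=
  if unlift ord0 i is Some j then existT _ (W j) (S j) else existT _ _ (branch T v).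
exists k.+1, (fun i => projT1 (F i)), (fun i => projT2 (F i)).
rewrite iso_sym; apply: iso_trans iT.
rewrite iso_sym; apply: iso_trans (joinS _).
apply: graft_iso; first by rewrite /F unlift_none; exact: iso_refl.
apply: iso_trans iS _; apply: join_iso => j.
by rewrite /F liftK; exact: iso_refl.
Qed.

End Joins.

(** * The relations satisfied by the weighted solution *)

Section Solution.
Variables (K : fieldType) (a : nat -> K) (P : tree -> {poly K}).
Hypothesis K_char0 : [pchar K] =i pred0.
Hypothesis P_sol : is_solution a P.

(** The weight is taken at the canonical representative, which makes it a function on classes, as
    [sum_cut_graft] requires. *)
Definition aut_weighted (t : tree) : {poly K} := #|Aut (repr (tagged t))|%:R *: P t.
Local Notation p := aut_weighted.

Lemma aut_weightedE (V : finType) (T : rtree V) : p (cls T) = #|Aut T|%:R *: P (cls T).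
Proof.
congr (_%:R *: _); apply: card_Aut_iso.
by rewrite iso_repr; apply/eqP; case: (cls T).
Qed.

(** The weights absorb exactly the automorphism factors of [prelie_cut], leaving one term for each
    edge. *)
Lemma deriv_aut_weighted (V : finType) (T : rtree V) :
  (p (cls T))^`() =
  \sum_(v | v != root T) umbral_functional a (p (cls (branch T v))) *: p (cls (trunk T v)).
Proof.
rewrite aut_weightedE derivZ scaler_nat (P_sol.1 _) prelie_cut; apply: eq_bigr => v vr.
by rewrite !aut_weightedE umbral_functionalZ mulr_natl scaler_nat -mul_polyC raddfMn.
Qed.

Lemma aut_weighted_bullet : p (cls bullet) = 1.
Proof.
apply: (poly_eq_deriv K_char0).
  rewrite deriv_aut_weighted big1 => [|[]]; last by rewrite root_mk eqxx.
  by rewrite derivC.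
rewrite aut_weightedE hornerZ (P_sol.2 _) eqxx mulr1 hornerC.
suff -> : #|Aut bullet| = 1%N by [].
rewrite -(card1 (1%g : {perm unit})); apply: eq_card => s; rewrite !inE.
have -> : s = 1%g by apply/permP => -[]; case: (s tt); rewrite perm1.
by rewrite eqxx; apply: is_iso_ext (is_iso_id bullet) => x; rewrite perm1.
Qed.

Lemma horner0_aut_weighted (V : finType) (T : rtree V) :
  (1 < #|V|)%N -> (p (cls T)).[0] = 0.
Proof.
move=> V1; rewrite aut_weightedE hornerZ (P_sol.2 _); case: eqP; last by rewrite mulr0.
by move/clsP/iso_card; rewrite card_unit => V1'; rewrite V1' in V1.
Qed.

(* This is p({T | \bullet}), see [join1]. *)
Definition planted (V : finType) (T : rtree V) : {poly K} :=
  p (cls (graft T (root bullet) bullet)).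

(** A graft has at least two vertices, so it is not [bullet] and the initial condition gives
    zero. *)
Lemma horner0_graft (V W : finType) (T : rtree V) w (S : rtree W) :
  (p (cls (graft T w S))).[0] = 0.
Proof.
apply: horner0_aut_weighted; rewrite card_sum -addn1 leq_add //; apply/card_gt0P.
  by exists (root T).
by exists w.
Qed.

Lemma deriv_graft_root (V W : finType) (T : rtree V) (S : rtree W) :
  (p (cls (graft T (root S) S)))^`() =
  umbral_functional a (p (cls T)) *: p (cls S)
  + \sum_(x | x != root T) umbral_functional a (p (cls (branch T x))) *:
      p (cls (graft (trunk T x) (root S) S))
  + \sum_(y | y != root S) umbral_functional a (p (cls (branch S y))) *:
      p (cls (graft T (root (trunk S y)) (trunk S y))).
Proof.
rewrite deriv_aut_weighted.
exact: (sum_cut_graft _ _ (fun t1 t2 => umbral_functional a (p t1) *: p t2)).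
Qed.

Lemma deriv_planted_cut (V : finType) (T : rtree V) :
  (planted T)^`() = (umbral_functional a (p (cls T)))%:P
    + \sum_(x | x != root T) umbral_functional a (p (cls (branch T x))) *: planted (trunk T x).
Proof.
rewrite deriv_graft_root aut_weighted_bullet alg_polyC -[RHS]addr0; congr (_ + _).
by rewrite big1 // => -[]; rewrite root_mk eqxx.
Qed.

(** Induction on the total number of vertices through the Leibniz rule: the first two terms of
    [deriv_graft_root] form the derivative of [planted T] times [p (cls S)], the last one
    [planted T] times the derivative of [p (cls S)]. *)
Lemma graft_root_mul (V W : finType) (T : rtree V) (S : rtree W) :
  p (cls (graft T (root S) S)) = planted T * p (cls S).
Proof.
have [n] := ubnP (#|V| + #|W|)%N; elim: n V W T S => // n IHn V W T S; rewrite ltnS => le.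
apply: (poly_eq_deriv K_char0); last by rewrite hornerM !horner0_graft mul0r.
rewrite derivM deriv_planted_cut deriv_graft_root deriv_aut_weighted.
rewrite mulrDl mul_polyC mulr_suml mulr_sumr.
congr (_ + _ + _); apply: eq_bigr => x xr.
  rewrite -scalerAl IHn //; apply: leq_trans le.
  by rewrite ltn_add2r trunk_lt.
rewrite -scalerAr IHn //; apply: leq_trans le.
by rewrite ltn_add2l trunk_lt.
Qed.

(** Since [g(D)] commutes with the derivative, differentiating once more reduces the claim to the
    smaller trunks. At zero both sides equal the umbral functional of [p (cls T)]. *)
Lemma deriv_planted (V : finType) (T : rtree V) :
  (planted T)^`() = umbral_operator a (p (cls T)).
Proof.
have [n] := ubnP #|V|; elim: n V T => // n IHn V T; rewrite ltnS => le.
apply: (poly_eq_deriv K_char0); rewrite deriv_planted_cut.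
  rewrite deriv_umbral_operator deriv_aut_weighted umbral_operator_sum.
  rewrite derivD derivC add0r raddf_sum /=; apply: eq_bigr => x xr.
  by rewrite derivZ umbral_operatorZ IHn // (leq_trans (trunk_lt xr)).
rewrite horner0_umbral_operator hornerD hornerC horner_sum big1 ?addr0 // => x _.
by rewrite hornerZ horner0_graft mulr0.
Qed.

Lemma planted_integral (V : finType) (T : rtree V) :
  planted T = integral0 (umbral_operator a (p (cls T))).
Proof.
apply: (poly_eq_deriv K_char0); first by rewrite deriv_planted deriv_integral0.
by rewrite horner0_graft horner0_integral0.
Qed.

Lemma cls_join1 (V : finType) (T : rtree V) :
  p (cls (join (fun _ : 'I_1 => T))) = planted T.
Proof. by congr p; apply/esym/clsP; exact: join1. Qed.

Lemma join_mul k (V : 'I_k -> finType) (T : forall i, rtree (V i)) :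
  p (cls (join T)) = \prod_(i < k) planted (T i).
Proof.
elim: k V T => [|k IHk] V T.
  by have /clsP-> := join0 T; rewrite big_ord0 aut_weighted_bullet.
by have /clsP<- := joinS T; rewrite graft_root_mul IHk big_ord_recl.
Qed.

Lemma aut_weighted_relations :
  tree_relations a (fun V (T : rtree V) => p (cls T)).
Proof.
split => [|k V T _|V T].
- exact: aut_weighted_bullet.
- by rewrite join_mul; apply: eq_bigr => i _; rewrite cls_join1.
- by rewrite cls_join1 planted_integral.
Qed.

End Solution.

(** * The relations determine all values *)

Lemma card_join k (V : 'I_k -> finType) (i : 'I_k) : (#|V i| < #|{: option {i & V i}}|)%N.
Proof.
rewrite card_option ltnS -(card_imset predT (f := fun x : V i => Tagged V x)).
  exact: max_card.
by move=> x y /eqP; rewrite eq_Tagged => /eqP.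
Qed.

(** The relations speak only of joins; by [iso_join] and invariance they reduce the value at any
    tree to values at its branches, which have fewer vertices. *)
Lemma tree_relations_unique (K : fieldType) (a : nat -> K)
    (p q : forall V : finType, rtree V -> {poly K}) :
  iso_invariant p -> iso_invariant q -> tree_relations a p -> tree_relations a q ->
  forall (V : finType) (T : rtree V), q V T = p V T.
Proof.
move=> ip iq [pb pI pII] [qb qI qII] V T.
have [n] := ubnP #|V|; elim: n V T => // n IHn V T; rewrite ltnS => le.
(* The product rule requires a positive number of branches; the empty join is [bullet], whose value
   is given separately. *)
have [[|k] [W [S iS]]] := iso_join T.
  have iT := iso_trans iS (join0 S).
  by rewrite (iq _ _ _ _ iT) (ip _ _ _ _ iT) pb qb.
rewrite (iq _ _ _ _ iS) (ip _ _ _ _ iS) pI // qI //; apply: eq_bigr => i _.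
rewrite pII qII IHn //; apply: leq_trans le.
by rewrite (iso_card iS); exact: card_join.
Qed.

(* K[[t]] is an integral domain, so g = t / f is expressed as f g = t. *)
Theorem theorem2p13 (K : fieldType) (K_char0 : [pchar K] =i pred0)
  (c a : nat -> K) (c1_neq0 : c 1%N != 0)
  (g_eq : fps_mul (egf1 c) (egf a) =1 @fps_X K)
  (P : tree -> {poly K}) (P_sol : is_solution a P) :
  let p (V : finType) (T : rtree V) : {poly K} := #|Aut T|%:R *: P (cls T) in
  tree_relations a p /\
  (forall q : forall V : finType, rtree V -> {poly K},
     iso_invariant q -> tree_relations a q ->
     forall (V : finType) (T : rtree V), q V T = p V T).
Proof.
move=> p.
have p_rel : tree_relations a p.
  have [pb pI pII] := aut_weighted_relations K_char0 P_sol.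
  rewrite /p; split => [|k V T k0|V T]; rewrite -!aut_weightedE //.
    by rewrite pI //; apply: eq_bigr => i _; rewrite aut_weightedE.
split=> // q iq q_rel; apply: tree_relations_unique p_rel q_rel => // V W T S TS.
by rewrite /p (card_Aut_iso TS) (clsP _ _ TS).
Qed.
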